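(* Let $G$ be a group, $N$ a $G$-set, $L$ a faithful $G$-set, $f\colon N\to L$ a map of sets and $h\colon L\to G$ a $G$-equivariant map (where $G$ acts on itself by left multiplication). The duplicial operator $t\colon\bar C(G,\{*\},N)\to\bar C(G,\{*\},N)$ given for $n\in\mathbb N$ by $$t_n([*,g_1,\ldots,g_{n+1},w])=[*,h(u),h(u)^{-1}(g_1,\ldots,g_n),g_{n+1}w],\qquad u=g_1\cdots g_{n+1}f(w),$$ is cyclic if and only if for all $w\in N$ and $g\in G$ one has $(h\circ f(w))^{-1}\in\mathrm{Stab}(w)$ and $(h\circ f(gw))^{-1}=g\,(h\circ f(w))^{-1}g^{-1}$.
   Context: $G$-sets are left $G$-sets. $\bar C(G,\{*\},N)$ is the simplicial set with $n$-simplices $\bar C_n(G,\{*\},N)=(\{*\}\times G^{\times(n+1)}\tilde\times N)/G$ ($n\ge0$), the set of orbits of $\{*\}\times G^{n+1}\times N$ under the action $g\cdot( *,g_1,g_2,\ldots,g_{n+1},w)=( *,gg_1,g_2,\ldots,g_{n+1},w)$; $[\ldots]$ denotes the orbit. Thus $[*,g_1,\ldots,g_{n+1},w]\mapsto(g_2,\ldots,g_{n+1},w)$ identifies $\bar C_n$ with $G^n\times N$. Faces and degeneracies: $d_0[*,g_1,\ldots,g_{n+1},w]=[*,g_2,\ldots,g_{n+1},w]$, $d_i[\ldots]=[*,g_1,\ldots,g_{i+1}g_{i+2},\ldots,g_{n+1},w]$ for $0<i<n$, $d_n[\ldots]=[*,g_1,\ldots,g_n,g_{n+1}w]$, and $s_i$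 inserts the unit $1$: $s_i[*,g_1,\ldots,g_{n+1},w]=[*,g_1,\ldots,g_i,1,g_{i+1},\ldots,g_{n+1},w]$. In the formula for $t_n$, the element $h(u)^{-1}$ acts on $(g_1,\ldots,g_n)$ by multiplying the first entry: $h(u)^{-1}(g_1,\ldots,g_n)=(h(u)^{-1}g_1,g_2,\ldots,g_n)$; for $n=0$ the formula is read as $t_0([*,g_1,w])=[*,h(u),h(u)^{-1}g_1w]$ with $u=g_1f(w)$. The operator $t$ is called cyclic if $t_n^{\,n+1}=\mathrm{id}$ for all $n$. $\mathrm{Stab}(w)=\{g\in G: gw=w\}$. *)

(* Defs.v *)
From mathcomp Require Import all_boot.
From mathcomp Require Import boolp classical_sets.
From mathcomp Require Import zify.

Set Implicit Arguments.
Unset Strict Implicit.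
Unset Printing Implicit Defensive.

Local Open Scope group_scope.
Local Open Scope classical_set_scope.

Record gset (G : groupType) := GSet {
  gset_carrier :> Type;
  act : G -> gset_carrier -> gset_carrier;
  act1g : forall x, act 1 x = x;
  actMg : forall a b x, act (a * b) x = act a (act b x) }.

Definition regular_gset (G : groupType) : gset G :=
  @GSet G G (fun a x => a * x) (@mul1g G) (fun a b x => esym (mulgA a b x)).

Definition equivariant (G : groupType) (X Y : gset G) (h : X -> Y) : Prop :=
  forall a x, h (act a x) = act a (h x).

Definition faithful_gset (G : groupType) (X : gset G) : Prop :=
  forall a : G, (forall x : X, act a x = x) -> a = 1.

Definition stab (G : groupType) (X : gset G) (x : X) : set G :=
  [set a | act a x = x].

Section Orbits.
Variable G : groupType.

Definition orbit (X : gset G) (x : X) : set X := range (fun a => act a x).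

Definition orbits (X : gset G) : Type := {S : set X | exists x, S = orbit x}.

Definition orbit_of (X : gset G) (x : X) : orbits X :=
  exist _ (orbit x) (ex_intro _ x erefl).

Lemma orbit_ofP (X : gset G) (S : orbits X) : exists x, S = orbit_of x.
Proof. by case: S => S [x Sx]; exists x; apply: eq_exist. Qed.

Lemma orbit_act (X : gset G) (a : G) (x : X) : orbit (act a x) = orbit x.
Proof.
apply/seteqP; split=> y [b _ <-]; first by exists (b * a); rewrite ?actMg.
by exists (b * a^-1); rewrite // -actMg mulgVK.
Qed.

Lemma orbit_of_act (X : gset G) (a : G) (x : X) :
  orbit_of (act a x) = orbit_of x.
Proof. by apply: eq_exist; exact: orbit_act. Qed.

Lemma orbit_of_eqP (X : gset G) (x y : X) :
  orbit_of x = orbit_of y <-> exists a, y = act a x.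
Proof.
split=> [[xy]|[a ->]]; last by rewrite orbit_of_act.
have [a _ <-] : orbit x y by rewrite xy; exists 1; rewrite ?act1g.
by exists a.
Qed.

Definition orbit_compatible (X Y : gset G) (phi : X -> Y) : Prop :=
  forall a x, orbit (phi (act a x)) = orbit (phi x).

Lemma orbit_map_subproof (X Y : gset G) (phi : X -> Y)
    (phiP : orbit_compatible phi) (S : orbits X) :
  exists y, \bigcup_(x in sval S) orbit (phi x) = orbit y.
Proof.
case: S => S Sx /=; case: (Sx) => x ->; exists (phi x); apply/seteqP; split=> y.
  by case=> _ [a _ <-]; rewrite phiP.
by exists x => //; exists 1; rewrite ?act1g.
Qed.

(* The map induced by phi on orbits, [x] |-> [phi x]; see orbit_mapE. *)
Definition orbit_map (X Y : gset G) (phi : X -> Y)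
    (phiP : orbit_compatible phi) (S : orbits X) : orbits Y :=
  exist _ (\bigcup_(x in sval S) orbit (phi x)) (orbit_map_subproof phiP S).

Lemma orbit_mapE (X Y : gset G) (phi : X -> Y) (phiP : orbit_compatible phi)
    (x : X) : orbit_map phiP (orbit_of x) = orbit_of (phi x).
Proof.
apply: eq_exist => /=; apply/seteqP; split=> y.
  by case=> _ [a _ <-]; rewrite phiP.
by exists x => //; exists 1; rewrite ?act1g.
Qed.

End Orbits.

(* In the identities the indices are natural numbers within the range where
   inord is the identity. *)
Record sset := SSet {
  simplices :> nat -> Type;
  face : forall n, 'I_n.+2 -> simplices n.+1 -> simplices n;
  degen : forall n, 'I_n.+1 -> simplices n -> simplices n.+1;
  face_face : forall n i j (x : simplices n.+2), (i < j <= n.+2)%N ->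
    face (inord i) (face (inord j) x) = face (inord j.-1) (face (inord i) x);
  face_degen_lt : forall n i j (x : simplices n.+1), (i < j <= n.+1)%N ->
    face (inord i) (degen (inord j) x) = degen (inord j.-1) (face (inord i) x);
  face_degen_eq : forall n j (x : simplices n), (j <= n)%N ->
    face (inord j) (degen (inord j) x) = x;
  face_degen_succ : forall n j (x : simplices n), (j <= n)%N ->
    face (inord j.+1) (degen (inord j) x) = x;
  face_degen_gt : forall n i j (x : simplices n.+1), (j.+1 < i <= n.+2)%N ->
    face (inord i) (degen (inord j) x) = degen (inord j) (face (inord i.-1) x);
  degen_degen : forall n i j (x : simplices n), (i <= j <= n)%N ->
    degen (inord i) (degen (inord j) x) = degen (inord j.+1) (degen (inord i) x)
}.

Record duplicial_operator (X : sset) := DuplicialOperator {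
  dupl :> forall n, X n -> X n;
  face_dupl0 : forall n (x : X n.+1),
    face (inord 0) (dupl x) = face (inord n.+1) x;
  face_dupl : forall n i (x : X n.+1), (0 < i <= n.+1)%N ->
    face (inord i) (dupl x) = dupl (face (inord i.-1) x);
  degen_dupl0 : forall n (x : X n),
    degen (inord 0) (dupl x) = dupl (dupl (degen (inord n) x));
  degen_dupl : forall n i (x : X n), (0 < i <= n)%N ->
    degen (inord i) (dupl x) = dupl (degen (inord i.-1) x) }.

Definition cyclic (X : sset) (t : duplicial_operator X) : Prop :=
  forall n (x : X n), iter n.+1 (t n) x = x.

Section Bar.
Variables (G : groupType) (N : gset G).

Definition entries m (F : nat -> G) : m.-tuple G := [tuple F j | j < m].

Lemma nth_entries m (F : nat -> G) j :
  (entries m F)`_j = if (j < m)%N then F j else 1.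
Proof.
case: ltnP => [jm|mj]; last by rewrite nth_default ?size_tuple.
by rewrite -(tnth_nth 1 _ (Ordinal jm)) tnth_mktuple.
Qed.

Opaque entries.

Section Gset.
Variable n : nat.

Definition bar_act (a : G) (x : n.+1.-tuple G * N) : n.+1.-tuple G * N :=
  (entries n.+1 (fun j => if j == 0 then a * x.1`_0 else x.1`_j), x.2).

Lemma bar_eq (x y : n.+1.-tuple G * N) :
  (forall j, (j < n.+1)%N -> x.1`_j = y.1`_j) -> x.2 = y.2 -> x = y.
Proof.
case: x y => g w [g' w'] /= E ->; congr (_, _).
by apply: eq_from_tnth => i; rewrite !(tnth_nth 1); exact: E.
Qed.

Lemma bar_act1 x : bar_act 1 x = x.
Proof.
apply: bar_eq => //= j jn; rewrite nth_entries jn.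
by case: eqP => [->|//]; rewrite mul1g.
Qed.

Lemma bar_actM a b x : bar_act (a * b) x = bar_act a (bar_act b x).
Proof.
apply: bar_eq => //= j jn; rewrite !nth_entries jn.
by case: eqP => //= _; rewrite mulgA.
Qed.

(* {*} x G^(n+1) x N without its one-point factor; for x = (g_1, ..., g_(n+1), w)
   the entry g_(j+1) is x.1`_j. *)
Definition bar_gset : gset G := GSet bar_act1 bar_actM.

End Gset.

(* d_0 drops g_1, d_i multiplies g_(i+1) and g_(i+2), and the last face
   makes the last group entry act on w. *)
Definition bar_face n (i : nat) (x : bar_gset n.+1) : bar_gset n :=
  let g := x.1 in
  (entries n.+1 (fun j => if i == 0 then g`_j.+1
                          else if (j < i)%N then g`_j
                          else if j == i then g`_j * g`_j.+1
                          else g`_j.+1),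
   if i == n.+1 then act g`_n.+1 x.2 else x.2).

(* The unit goes right after g_(i+1), for 0 <= i <= n: inserting it before g_1
   would not be well defined on orbits. *)
Definition bar_degen n (i : nat) (x : bar_gset n) : bar_gset n.+1 :=
  (entries n.+2 (fun j => if (j <= i)%N then x.1`_j
                          else if j == i.+1 then 1
                          else x.1`_j.-1),
   x.2).

(* Splits all decidable index conditions and compares the remaining entries. *)
Ltac idx := repeat (case: ifP => ? //=; try lia);
  rewrite ?mulgA ?mulg1 ?mul1g; try (by []);
  repeat (try (congr (_ * _)); try (congr (nth 1 _ _))); try lia;
  try (by rewrite nth_default // size_tuple; lia).

Lemma bar_face_compat n i : orbit_compatible (@bar_face n i).
Proof.
move=> a x; case: (eqVneq i 0%N) => [->|i0].
  congr orbit; apply: bar_eq => //= j jn; rewrite !nth_entries.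
  by idx.
rewrite -[RHS](orbit_act a); congr orbit; apply: bar_eq => [j jn|] /=.
  by rewrite ?nth_entries; idx.
by rewrite ?nth_entries; idx.
Qed.

Lemma bar_degen_compat n i : orbit_compatible (@bar_degen n i).
Proof.
move=> a x; rewrite -[RHS](orbit_act a); congr orbit.
apply: bar_eq => [j jn|] //=.
by rewrite ?nth_entries; idx.
Qed.

Definition bar_simplices (n : nat) : Type := orbits (bar_gset n).

Definition bar_d n (i : 'I_n.+2) : bar_simplices n.+1 -> bar_simplices n :=
  orbit_map (@bar_face_compat n i).

Definition bar_s n (i : 'I_n.+1) : bar_simplices n -> bar_simplices n.+1 :=
  orbit_map (@bar_degen_compat n i).

Lemma bar_dE n i x : (i <= n.+1)%N ->
  bar_d (inord i) (orbit_of x) = orbit_of (@bar_face n i x).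
Proof. by move=> h; rewrite /bar_d orbit_mapE inordK. Qed.

Lemma bar_sE n i x : (i <= n)%N ->
  bar_s (inord i) (orbit_of x) = orbit_of (@bar_degen n i x).
Proof. by move=> h; rewrite /bar_s orbit_mapE inordK. Qed.

Lemma bar_face_face n i j (x : bar_simplices n.+2) : (i < j <= n.+2)%N ->
  bar_d (inord i) (bar_d (inord j) x) = bar_d (inord j.-1) (bar_d (inord i) x).
Proof.
case: (orbit_ofP x) => {}x -> ij.
rewrite !bar_dE; [|lia..].
have [i0|i0] := eqVneq i 0%N; last first.
  congr orbit_of; apply: bar_eq => [k kn|] /=.
    by rewrite ?nth_entries; idx.
  by rewrite ?nth_entries; idx; rewrite -actMg; congr (act _ _); idx.
have [j1|j1] := eqVneq j 1%N; last first.
  congr orbit_of; apply: bar_eq => [k kn|] /=.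
    by rewrite ?nth_entries; idx.
  by rewrite ?nth_entries; idx.
subst; rewrite -[RHS](orbit_of_act x.1`_1).
congr orbit_of; apply: bar_eq => [k kn|] /=.
  by rewrite ?nth_entries; idx.
by idx.
Qed.

Lemma bar_face_degen_lt n i j (x : bar_simplices n.+1) : (i < j <= n.+1)%N ->
  bar_d (inord i) (bar_s (inord j) x) = bar_s (inord j.-1) (bar_d (inord i) x).
Proof.
case: (orbit_ofP x) => {}x -> ij.
rewrite bar_sE ?bar_dE ?bar_sE; [|lia..].
congr orbit_of; apply: bar_eq => [k kn|] /=.
  by rewrite ?nth_entries; idx.
by rewrite ?nth_entries; idx.
Qed.

Lemma bar_face_degen_eq n j (x : bar_simplices n) : (j <= n)%N ->
  bar_d (inord j) (bar_s (inord j) x) = x.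
Proof.
case: (orbit_ofP x) => {}x -> jn.
rewrite bar_sE ?bar_dE; [|lia..].
have [j0|j0] := eqVneq j 0%N.
  subst; rewrite -[LHS](orbit_of_act x.1`_0).
  congr orbit_of; apply: bar_eq => [k kn|] /=.
    by rewrite ?nth_entries; idx.
  by rewrite ?nth_entries; idx.
congr orbit_of; apply: bar_eq => [k kn|] /=.
  by rewrite ?nth_entries; idx.
by rewrite ?nth_entries; idx; rewrite act1g.
Qed.

Lemma bar_face_degen_succ n j (x : bar_simplices n) : (j <= n)%N ->
  bar_d (inord j.+1) (bar_s (inord j) x) = x.
Proof.
case: (orbit_ofP x) => {}x -> jn.
rewrite bar_sE ?bar_dE; [|lia..].
congr orbit_of; apply: bar_eq => [k kn|] /=.
  by rewrite ?nth_entries; idx.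
by rewrite ?nth_entries; idx; rewrite act1g.
Qed.

Lemma bar_face_degen_gt n i j (x : bar_simplices n.+1) :
  (j.+1 < i <= n.+2)%N ->
  bar_d (inord i) (bar_s (inord j) x) = bar_s (inord j) (bar_d (inord i.-1) x).
Proof.
case: (orbit_ofP x) => {}x -> ij.
rewrite bar_sE ?bar_dE ?bar_sE; [|lia..].
congr orbit_of; apply: bar_eq => [k kn|] /=.
  by rewrite ?nth_entries; idx.
by rewrite ?nth_entries; idx.
Qed.

Lemma bar_degen_degen n i j (x : bar_simplices n) : (i <= j <= n)%N ->
  bar_s (inord i) (bar_s (inord j) x) = bar_s (inord j.+1) (bar_s (inord i) x).
Proof.
case: (orbit_ofP x) => {}x -> ij.
rewrite !bar_sE; [|lia..].
congr orbit_of; apply: bar_eq => [k kn|] //=.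
by rewrite ?nth_entries; idx.
Qed.

Definition bar_sset : sset :=
  SSet bar_face_face bar_face_degen_lt bar_face_degen_eq bar_face_degen_succ
    bar_face_degen_gt bar_degen_degen.

Section Dupl.
Variables (L : gset G) (f : N -> L) (h : L -> regular_gset G).

Definition bar_u n (x : bar_gset n) : L :=
  act (\prod_(a <- x.1) a) (f x.2).

(* The image of (g_1, ..., g_(n+1), w) is
   (h(u), h(u)^-1 g_1, g_2, ..., g_n, g_(n+1) w), where u = bar_u x; for n = 0
   it is (h(u), h(u)^-1 g_1 w). *)
Definition bar_dupl n (x : bar_gset n) : bar_gset n :=
  let g := x.1 in
  let hu : G := h (bar_u x) in
  (entries n.+1 (fun j => if j == 0 then hu
                          else if j == 1%N then hu^-1 * g`_0
                          else g`_j.-1),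
   act (if n == 0 then hu^-1 * g`_0 else g`_n) x.2).

Hypothesis hP : equivariant h.

Lemma prodE m (g : m.-tuple G) :
  \prod_(a <- g) a = \prod_(0 <= j < m) g`_j.
Proof. by rewrite (big_nth 1) size_tuple. Qed.

Lemma prod_nat_entries m (F : nat -> G) :
  \prod_(a <- entries m F) a = \prod_(0 <= j < m) F j.
Proof.
rewrite prodE; apply: eq_big_nat => j /andP[_ jm].
by rewrite nth_entries jm.
Qed.

Lemma bar_u_act n a (x : bar_gset n) : bar_u (act a x) = act a (bar_u x).
Proof.
rewrite /bar_u -actMg; congr act; rewrite prod_nat_entries prodE.
by rewrite !big_nat_recl //= mulgA.
Qed.

Lemma h_act a l : h (act a l) = a * h l.
Proof. exact: hP. Qed.

Lemma bar_dupl_compat n : orbit_compatible (@bar_dupl n).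
Proof.
move=> a x; rewrite -[RHS](orbit_act a); congr orbit.
apply: bar_eq => [j jn|] /=; rewrite ?nth_entries /= bar_u_act h_act invgM.
  by idx; rewrite mulgVK.
by case: eqP => [n0|]; idx; rewrite ?mulgVK.
Qed.

Definition bar_t n : bar_simplices n -> bar_simplices n :=
  orbit_map (@bar_dupl_compat n).

Lemma bar_tE n (x : bar_gset n) : bar_t (orbit_of x) = orbit_of (bar_dupl x).
Proof. exact: orbit_mapE. Qed.

Lemma big_nat_merge m (F : nat -> G) i : (i < m)%N ->
  \prod_(0 <= j < m.+1) F j =
  \prod_(0 <= j < m) (if (j < i)%N then F j
                      else if j == i then F j * F j.+1 else F j.+1).
Proof.
elim: m => // m IH im.
have [im'|mi] := ltnP i m.
  rewrite big_nat_recr //= IH // [RHS]big_nat_recr //=.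
  by congr (_ * _); idx.
have -> : i = m by lia.
rewrite !big_nat_recr //= eqxx ltnn mulgA; congr (_ * _ * _).
by apply: eq_big_nat => j /andP[_ jm]; rewrite jm.
Qed.

Lemma bar_u_face n i (x : bar_gset n.+1) : (0 < i <= n)%N ->
  bar_u (bar_face i x) = bar_u x.
Proof.
move=> ij; rewrite /bar_u prod_nat_entries prodE /=.
rewrite (_ : (i == n.+1) = false); last by lia.
rewrite [in RHS](@big_nat_merge _ _ i); last by lia.
by rewrite (_ : (i == 0) = false); last by lia.
Qed.

Lemma bar_u_face0 n (x : bar_gset n.+1) :
  bar_u x = act x.1`_0 (bar_u (bar_face 0 x)).
Proof.
by rewrite /bar_u -actMg prod_nat_entries prodE /= big_nat_recl.
Qed.

Lemma bar_u_degen n i (x : bar_gset n) : (i <= n)%N ->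
  bar_u (bar_degen i x) = bar_u x.
Proof.
move=> ij; rewrite /bar_u prod_nat_entries prodE /=.
rewrite (@big_nat_merge _ _ i); last by lia.
congr act; apply: eq_big_nat => j /andP[_ jn].
by idx.
Qed.

Lemma bar_face_dupl0 n (x : bar_simplices n.+1) :
  bar_d (inord 0) (bar_t x) = bar_d (inord n.+1) x.
Proof.
case: (orbit_ofP x) => {}x ->.
rewrite bar_tE !bar_dE //.
rewrite -[LHS](orbit_of_act (h (bar_u x))).
congr orbit_of; apply: bar_eq => [k kn|] /=; rewrite ?nth_entries.
  by idx; rewrite mulgV mul1g; idx.
by idx.
Qed.

Lemma bar_face_dupl n i (x : bar_simplices n.+1) : (0 < i <= n.+1)%N ->
  bar_d (inord i) (bar_t x) = bar_t (bar_d (inord i.-1) x).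
Proof.
case: (orbit_ofP x) => {}x -> i0.
rewrite bar_tE !bar_dE ?bar_tE; [|lia..].
have [i1|i1] := eqVneq i 1%N.
  subst; rewrite -[RHS](orbit_of_act x.1`_0).
  congr orbit_of; apply: bar_eq => [k kn|] /=; rewrite ?nth_entries;
    rewrite bar_u_face0 h_act invgM /=.
    by idx; rewrite mulgVK.
  by idx; rewrite -actMg mulgVK; congr (act (_ * nth 1 _ _) _); lia.
congr orbit_of; apply: bar_eq => [k kn|] /=; rewrite ?nth_entries;
  rewrite bar_u_face; try lia.
  by idx.
by idx; rewrite -actMg.
Qed.

Lemma bar_degen_dupl0 n (x : bar_simplices n) :
  bar_s (inord 0) (bar_t x) = bar_t (bar_t (bar_s (inord n) x)).
Proof.
case: (orbit_ofP x) => {}x ->.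
rewrite bar_tE !bar_sE ?bar_tE; [|lia..].
have u2 : h (bar_u (bar_dupl (bar_degen n x))) = h (bar_u x).
  congr (h _); rewrite /bar_u prod_nat_entries prodE /=.
  rewrite !nth_entries ltnSn /= ltnn eqxx act1g.
  rewrite big_nat_recl // big_nat_recl // [in RHS]big_nat_recl //=.
  rewrite !mulgA bar_u_degen // mulgV mul1g; congr (act (_ * _) _).
  by apply: eq_big_nat => j /andP[_ jn]; rewrite nth_entries; idx.
congr orbit_of; apply: bar_eq => [k kn|] /=; rewrite ?nth_entries /=.
  by rewrite u2 bar_u_degen //; idx; rewrite mulVg.
by rewrite bar_u_degen //; idx; rewrite act1g.
Qed.

Lemma bar_degen_dupl n i (x : bar_simplices n) : (0 < i <= n)%N ->
  bar_s (inord i) (bar_t x) = bar_t (bar_s (inord i.-1) x).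
Proof.
case: (orbit_ofP x) => {}x -> i0.
rewrite bar_tE !bar_sE ?bar_tE; [|lia..].
congr orbit_of; apply: bar_eq => [k kn|] /=; rewrite ?nth_entries.
  by rewrite bar_u_degen; [idx|lia].
by idx.
Qed.

Definition bar_duplicial : duplicial_operator bar_sset :=
  @DuplicialOperator bar_sset bar_t
    bar_face_dupl0 bar_face_dupl bar_degen_dupl0 bar_degen_dupl.

End Dupl.

Transparent entries.

End Bar.

(* Main.v *)
(* Every orbit has a representative (g_1, ..., g_(n+1), w) with
   g_1 ... g_(n+1) = (h (f w))^-1, that is, with h(u) = 1. On it t is the
   rotation (g_1, ..., g_(n+1), w) |-> (g_(n+1), g_1, ..., g_n, g_(n+1) w), and
   conjugation equivariance of w |-> (h (f w))^-1 says that the rotated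
   representative is again of this form. The (n+1)-st power of the rotation
   restores the group entries and multiplies w by g_1 ... g_(n+1) =
   (h (f w))^-1, which fixes w. Conversely, the two conditions are read off
   from t_0 = id and t_1^2 = id on such representatives. *)
Require Import Defs.
From mathcomp Require Import all_boot.
From mathcomp Require Import boolp classical_sets.
From mathcomp Require Import zify.

Local Open Scope group_scope.

#[local] Opaque entries.

Section Rotation.

Set Implicit Arguments.
Unset Strict Implicit.

Variables (G : groupType) (N L : gset G) (f : N -> L) (h : L -> regular_gset G).
Hypothesis hP : equivariant h.

Definition bar_rot n (x : bar_gset N n) : bar_gset N n :=
  ([tuple of rotr 1 x.1], act x.1`_n x.2).

Definition balanced n (x : bar_gset N n) : Prop :=
  \prod_(a <- x.1) a = (h (f x.2))^-1.

Lemma h_bar_u n (x : bar_gset N n) :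
  h (bar_u f x) = \prod_(a <- x.1) a * h (f x.2).
Proof. exact: hP. Qed.

Lemma nth_rotr1 n (s : n.+1.-tuple G) j : (j < n.+1)%N ->
  (rotr 1 s)`_j = if j == 0 then s`_n else s`_j.-1.
Proof.
case: s => s /= /eqP; case/lastP: s => // s b; rewrite size_rcons => -[sn] jn.
rewrite rotr1_rcons !nth_rcons sn ltnn eqxx; case: j jn => //= j jn.
by rewrite ifT.
Qed.

Lemma prod_rotr1 n (s : n.+1.-tuple G) :
  \prod_(a <- rotr 1 s) a = s`_n * \prod_(a <- s) a * (s`_n)^-1.
Proof.
case: s => s /= /eqP; case/lastP: s => // s b; rewrite size_rcons => -[sn].
rewrite rotr1_rcons nth_rcons sn ltnn eqxx big_cons -cats1 big_cat /= big_seq1.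
by rewrite -!mulgA mulgV mulg1.
Qed.

Lemma balanced_repr n (S : orbits (bar_gset N n)) :
  exists2 x : bar_gset N n, S = orbit_of x & balanced x.
Proof.
case: (orbit_ofP S) => x ->.
(* This translation replaces u by h(u)^-1 u, which equivariance sends to 1. *)
exists (act (h (bar_u f x))^-1 x); first by rewrite orbit_of_act.
apply: (mulIg (h (f x.2))); rewrite mulVg.
have := h_bar_u (act (h (bar_u f x))^-1 x).
by rewrite bar_u_act hP /= mulVg => <-.
Qed.

Lemma bar_t_balanced n (x : bar_gset N n) : balanced x ->
  bar_t f hP (orbit_of x) = orbit_of (bar_rot x).
Proof.
(* Here [bar_dupl] puts h(u) = 1 in front; translating by g_(n+1) gives the rotation. *)
move=> bx; rewrite bar_tE -[LHS](orbit_of_act x.1`_n).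
have hu : h (bar_u f x) = 1 by rewrite h_bar_u bx mulVg.
congr orbit_of; apply: bar_eq => [j jn|] /=; rewrite hu invg1 mul1g; last first.
  by case: n x {bx hu}.
rewrite !nth_entries nth_rotr1 // jn /=.
by case: j jn => [|[|j]] //= _; rewrite mulg1.
Qed.

Lemma iter_bar_rot n (x : bar_gset N n) m : (m <= n.+1)%N ->
  val (iter m (@bar_rot n) x).1 = rotr m x.1 /\
  (iter m (@bar_rot n) x).2 = act (\prod_(a <- drop (n.+1 - m) x.1) a) x.2.
Proof.
have sx : size x.1 = n.+1 by rewrite size_tuple.
elim: m => [|m IH] mn.
  by rewrite subn0 drop_oversize ?sx // big_nil act1g /rotr subn0 rot_size.
have [IH1 IH2] := IH (ltnW mn); rewrite iterS; split.
  (* As [rotr m] is [rot (n.+1 - m)], one more [rotr 1] cancels one [rot 1]. *)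
  rewrite /= IH1 {2 3}/rotr sx (_ : n.+1 - m = (n.+1 - m.+1).+1)%N; last by lia.
  by rewrite rotS ?rotK // sx; lia.
(* The next entry to act, g_(n+1-m), is the head of the longer suffix. *)
rewrite /= IH1 IH2 -actMg (drop_nth 1 (n := n.+1 - m.+1)) ?sx; last by lia.
rewrite big_cons (_ : (n.+1 - m.+1).+1 = n.+1 - m)%N; last by lia.
congr (act (_ * _) _).
rewrite /rotr /rot sx nth_cat size_drop sx ifF; last by lia.
by rewrite nth_take; [congr nth; lia | lia].
Qed.

Lemma bar_rot_period n (x : bar_gset N n) : balanced x ->
  stab x.2 (h (f x.2))^-1 -> iter n.+1 (@bar_rot n) x = x.
Proof.
move=> bx sx; have [E1 E2] := iter_bar_rot x (leqnn n.+1).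
apply: bar_eq => [j _|]; last by rewrite E2 subnn drop0 bx.
by rewrite E1 /rotr size_tuple subnn rot0.
Qed.

(** Rotation conjugates the product by g_(n+1), matching the change of (h (f w))^-1 as w becomes
    g_(n+1) w. *)
Lemma balanced_bar_rot n (x : bar_gset N n) :
  (forall g, (h (f (act g x.2)))^-1 = g * (h (f x.2))^-1 * g^-1) ->
  balanced x -> balanced (bar_rot x).
Proof. by move=> conj bx; rewrite /balanced /= prod_rotr1 bx conj. Qed.

End Rotation.

Theorem theorem1p6 (G : groupType) (N L : gset G) (faithfulL : faithful_gset L)
    (f : N -> L) (h : L -> regular_gset G) (equivariant_h : equivariant h) :
  cyclic (bar_duplicial f equivariant_h) <->
  (forall (w : N) (g : G),
     stab w (h (f w))^-1 /\
     (h (f (act g w)))^-1 = g * (h (f w))^-1 * g^-1).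
Proof.
split=> [cyc w g | cond n S].
  split.
    pose x : bar_gset N 0 := ([tuple (h (f w))^-1], w).
    have := cyc 0 (orbit_of x); rewrite /= bar_t_balanced; last first.
      by rewrite /balanced big_seq1.
    (* Translation within an orbit leaves the component in [N] unchanged. *)
    by case/orbit_of_eqP => a /(congr1 snd) /= /esym.
  (* Balanced with last entry g, so the first t moves w to g w. *)
  pose x : bar_gset N 1 := ([tuple (h (f w))^-1 * g^-1; g], w).
  have := cyc 1%N (orbit_of x); rewrite /= bar_t_balanced; last first.
    by rewrite /balanced big_cons big_seq1 mulgVK.
  (* The rotated tuple is not yet known to be balanced, so the second t is expanded. Translation
     fixes the second entry, hence g = h(u)^-1 g and h(u) = 1. *)
  rewrite bar_tE => /orbit_of_eqP [a /(congr1 (fun y : bar_gset N 1 => y.1`_1))] /=.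
  rewrite !nth_entries /= h_bar_u // prod_rotr1 /= big_cons big_seq1 mulgVK.
  move=> /(congr1 (fun y => y * g^-1)); rewrite mulgK mulgV => /esym/eqP.
  by rewrite invg_eq1 => /eqP/mulg1_eq <-; rewrite invgK.
have [x -> bx] := balanced_repr f equivariant_h S.
(* Balance is carried along so that each further t is again a rotation. *)
have iterE m : balanced f h (iter m (@bar_rot G N n) x) /\
    iter m (bar_t f equivariant_h (n := n)) (orbit_of x) =
    orbit_of (iter m (@bar_rot G N n) x).
  elim: m => // m [bm IH]; rewrite !iterS IH bar_t_balanced //; split=> //.
  apply: balanced_bar_rot => // g.
  by have [] := cond (iter m (@bar_rot G N n) x).2 g.
rewrite (iterE n.+1).2 (bar_rot_period (f := f) (h := h)) //.
by have [] := cond x.2 1.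
Qed.
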